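(* Let $C_1$ and $C_2$ be two distinct primitive 6-cycles in $\Gamma(B_n)$, both associated with the same pair $s_i, s_{i+1}$ of simple transpositions (for some $1\le i\le n-2$). Choose a shortest path in $\Gamma(B_n)$ from $C_1$ to $C_2$ (a path of minimal length among all paths from a vertex of $C_1$ to a vertex of $C_2$), and let $\sigma_1\in C_1$ be its initial vertex and $\gamma_1\in C_2$ its final vertex. Label the vertices of $C_1$ as $\sigma_1,\dots,\sigma_6$ and those of $C_2$ as $\gamma_1,\dots,\gamma_6$ by going around each cycle in the $s_i$ direction, i.e. $\sigma_2=\sigma_1 s_i$, $\sigma_3=\sigma_1 s_i s_{i+1}$, $\sigma_4=\sigma_1 s_is_{i+1}s_i$, and so on, and likewise $\gamma_2=\gamma_1 s_i$, $\gamma_3=\gamma_1 s_i s_{i+1}$, and so on. Then $C_1\simeq_G C_2$ if and only if there exist $k\ge 1$ and simple transpositions $\tau_1,\dots,\tau_k\in\{s_1,\dots,s_{n-1}\}$, each disjoint from $s_i$ and from $s_{i+1}$, such that $\gamma_j=\sigma_j\tau_1\cdots\tau_k$ for all $j=1,\dots,6$.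
   Context: Let $S_n$ be the symmetric group on $\{1,\dots,n\}$, with permutations multiplied from right to left, and let $s_j=(j\ \ j{+}1)$, $1\le j\le n-1$, be the simple transpositions. Two transpositions are disjoint if they move no common point; so $s_j$ is disjoint from both $s_i$ and $s_{i+1}$ iff $|j-i|\ge 2$ and $|j-(i+1)|\ge 2$. $\Gamma(B_n)$ is the simple graph with vertex set $S_n$ in which $\sigma$ and $\tau$ are adjacent iff $\sigma=\tau s_j$ for some $1\le j\le n-1$; the edge between $\tau$ and $\tau s_j$ is labeled $s_j$. (It is the 1-skeleton of the permutahedron.) A primitive 6-cycle is a 6-cycle whose edges are labeled alternately $s_j,s_{j+1},s_j,s_{j+1},s_j,s_{j+1}$ for some $1\le j\le n-2$ (it corresponds to the relation $(s_js_{j+1})^3=1$); it is said to be associated with the pair $s_j,s_{j+1}$. Cycles are regarded as subgraphs. A graph map between simple graphs is a map on vertices sending adjacent vertices to adjacent or equal vertices. The cartesian product $\Gamma\,\Box\,\Gamma'$ has vertex set $V\times V'$, with $(v,v')$ adjacent to $(w,w')$ iff either $v=w$ and $v'\sim w'$, or $v\sim w$ and $v'=w'$. Let $I$ be the infinite path with vertices $0,1,2,\dots$ and $I_m$ the path with vertices $0,1,\dots,m$. A loop in a graph $\Gamma$ based at $v_0$ is a graph map $f:I\to\Gamma$ with $f(0)=v_0$ and $f(r)=v_0$ for all sufficiently large $r$; a closed walk from $v_0$ to $v_0$ is regarded as a loop by extending it by the constant value $v_0$. Two loops $f,g$ based at $v_0$ are $G$-homotopic if there are an integer $m$ and a graph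 map $F:I\,\Box\, I_m\to\Gamma$ with $F(r,0)=f(r)$ and $F(r,m)=g(r)$ for all $r$, and such that each row $r\mapsto F(r,j)$, $0\le j\le m$, is a loop based at $v_0$. Fix a base permutation $\sigma_0\in S_n$. For primitive 6-cycles $C_1,C_2$ of $\Gamma(B_n)$, write $C_1\simeq_G C_2$ if there exist paths $P_1,P_2$ from $\sigma_0$ to a vertex of $C_1$, respectively of $C_2$, such that the loops $P_1C_1P_1^{-1}$ and $P_2C_2P_2^{-1}$ based at $\sigma_0$ are $G$-homotopic. Here $C_k$, if associated with $s_j,s_{j+1}$, is traversed once, starting and ending at the endpoint of $P_k$, with the first edge traversed labeled $s_j$, and $P_k^{-1}$ is $P_k$ traversed backwards. *)

(* Defs.v *)
From HB Require Import structures.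
From mathcomp Require Import all_boot all_fingroup.

Set Implicit Arguments.
Unset Strict Implicit.
Unset Printing Implicit Defensive.

Record sgraph := SGraph {
  vertex :> eqType;
  adj : rel vertex;
  adj_sym : symmetric adj;
  adj_irr : irreflexive adj }.

Definition graph_map (G H : sgraph) (f : G -> H) : Prop :=
  forall x y : G, adj x y -> f x = f y \/ adj (f x) (f y).

Section CartesianProduct.
Variables G H : sgraph.

Definition box_adj : rel (G * H)%type := fun x y =>
  (x.1 == y.1) && adj x.2 y.2 || adj x.1 y.1 && (x.2 == y.2).

Fact box_adj_sym : symmetric box_adj.
Proof.
move=> x y; rewrite /box_adj (eq_sym x.1) (eq_sym x.2).
by rewrite (adj_sym x.1) (adj_sym x.2).
Qed.

Fact box_adj_irr : irreflexive box_adj.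
Proof. by move=> x; rewrite /box_adj !adj_irr andbF. Qed.

Definition box : sgraph := SGraph box_adj_sym box_adj_irr.

End CartesianProduct.

Definition nat_adj : rel nat := fun r q => (q == r.+1) || (r == q.+1).

Fact nat_adj_sym : symmetric nat_adj.
Proof. by move=> r q; rewrite /nat_adj orbC. Qed.

Fact nat_adj_irr : irreflexive nat_adj.
Proof. by move=> r; rewrite /nat_adj orbb ltn_eqF. Qed.

Definition path_inf : sgraph := SGraph nat_adj_sym nat_adj_irr.

(* The path with vertices 0, ..., m, that is, with m edges. *)
Definition path_fin (m : nat) : sgraph :=
  @SGraph 'I_m.+1 (fun x y => nat_adj x y)
    (fun x y => nat_adj_sym x y) (fun x => nat_adj_irr x).

Definition loop (G : sgraph) (v0 : G) (f : nat -> G) : Prop :=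
  [/\ @graph_map path_inf G f, f 0 = v0 &
      exists N, forall r, N <= r -> f r = v0].

Definition G_homotopic (G : sgraph) (v0 : G) (f g : nat -> G) : Prop :=
  exists (m : nat) (F : box path_inf (path_fin m) -> G),
    [/\ graph_map F,
        forall r : nat, F (r, ord0) = f r,
        forall r : nat, F (r, ord_max) = g r &
        forall j : 'I_m.+1, loop v0 (fun r : nat => F (r, j))].

(* As in [path.v], the walk x, p_0, p_1, ... is given by x and the sequence p;
   the default value of [nth] extends a closed walk at v0 by the constant v0. *)
Definition loop_of_walk (G : sgraph) (v0 : G) (p : seq G) : nat -> G :=
  nth v0 (v0 :: p).

(* P C P^-1, where P = (v0, p) and C = (last v0 p, c) is a closed walk. *)
Definition lasso (G : sgraph) (v0 : G) (p c : seq G) : seq G :=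
  p ++ c ++ rev (belast v0 p).

Definition shortest_path (G : sgraph) (A B : {pred G}) (x : G) (p : seq G)
    (y : G) : Prop :=
  [/\ x \in A, y \in B, path (@adj G) x p, last x p = y &
      forall (x' : G) (q : seq G),
        x' \in A -> path (@adj G) x' q -> last x' q \in B -> size p <= size q].

Record subgraph (T : finType) := Subgraph {
  sub_vertices : {set T};
  sub_edges : {set {set T}} }.

(* [ordS] is the cyclic successor on 'I_m. *)
Definition is_cycle (G : sgraph) (m : nat) (c : 'I_m -> G) : Prop :=
  [/\ 2 < m, injective c & forall k, adj (c k) (c (ordS k))].

Definition cycle_subgraph (T : finType) (m : nat) (c : 'I_m -> T) :
    subgraph T :=
  Subgraph [set c k | k : 'I_m] [set [set c k; c (ordS k)] | k : 'I_m].

(* Product of permutations from right to left, (s ∘ t) x = s (t x), whereas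
   the product of the library is from left to right. *)
Definition perm_comp (T : finType) (s t : {perm T}) : {perm T} := (t * s)%g.

Notation "s ∘ t" := (perm_comp s t) (at level 40, left associativity).

Section Permutahedron.
Variable n : nat.
Implicit Types (i j : 'I_n.-1) (x y : 'S_n) (C : subgraph 'S_n).

Fact simple_subproof j : j.+1 < n.
Proof. by case: n j => [[]|m j] //=; rewrite ltnS. Qed.

(* The points 1, ..., n and the indices 1, ..., n - 1 of the simple
   transpositions are shifted down by one. *)
Definition simple j : 'S_n :=
  tperm (Ordinal (ltnW (simple_subproof j))) (Ordinal (simple_subproof j)).

Definition disjoint_perm x y : Prop :=
  forall a : 'I_n, ~ (x a != a /\ y a != a).

Definition permutahedron_adj : rel 'S_n :=
  fun x y => [exists j, x == y ∘ simple j].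

Fact permutahedron_adj_sym : symmetric permutahedron_adj.
Proof.
move=> x y; apply/existsP/existsP => -[j /eqP->]; exists j; apply/eqP.
  by rewrite /perm_comp mulgA tperm2 mul1g.
by rewrite /perm_comp mulgA tperm2 mul1g.
Qed.

Fact permutahedron_adj_irr : irreflexive permutahedron_adj.
Proof.
move=> x; apply/existsP => -[j /eqP /(congr1 (fun y => y * x^-1)%g)].
rewrite /perm_comp mulgK mulgV.
move=> /permP /(_ (Ordinal (simple_subproof j))).
by rewrite perm1 tpermR => /(congr1 val) /= /eqP; rewrite eqn_leq ltnn ?andbF.
Qed.

Definition permutahedron : sgraph :=
  SGraph permutahedron_adj_sym permutahedron_adj_irr.

Definition edge_label x y j : Prop := y = x ∘ simple j.

Definition primitive6 i i' C : Prop :=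
  i' = i.+1 :> nat /\
  exists c : 'I_6 -> 'S_n,
    [/\ @is_cycle permutahedron 6 c,
        forall k : 'I_6,
          edge_label (c k) (c (ordS k)) (if odd k then i' else i) &
        C = cycle_subgraph c].

(* x, x s_i, x s_i s_i', x s_i s_i' s_i, ... *)
Fixpoint around i i' x (k : nat) : 'S_n :=
  if k is k'.+1 then around i i' x k' ∘ simple (if odd k' then i' else i)
  else x.

(* c follows C once, starting and ending at x, the first edge being labelled
   by the first element of the pair associated with C. *)
Definition traversal C x (c : seq 'S_n) : Prop :=
  exists i i', [/\ primitive6 i i' C, x \in sub_vertices C &
                   c = [seq around i i' x k | k <- iota 1 6]].

Definition cycle_equiv (x0 : 'S_n) C1 C2 : Prop :=
  exists p1 p2 c1 c2 : seq 'S_n,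
    [/\ path permutahedron_adj x0 p1, path permutahedron_adj x0 p2,
        traversal C1 (last x0 p1) c1, traversal C2 (last x0 p2) c2 &
        @G_homotopic permutahedron x0
          (@loop_of_walk permutahedron x0 (@lasso permutahedron x0 p1 c1))
          (@loop_of_walk permutahedron x0 (@lasso permutahedron x0 p2 c2))].

End Permutahedron.

(* Main.v *)
Require Import Defs.
From mathcomp Require Import all_boot all_fingroup.
From mathcomp Require Import zify.

(** Fix a set A and a pair B of values, and mark the edges x - x s_i such that
    x maps the positions before i onto A and the positions {i, i+1} onto B.
    Every closed walk of length 4 crosses an even number of marked edges: if
    such a walk does not backtrack, its labels alternate between two commuting
    transpositions, and the opposite edge of a marked edge is marked.  So the
    parity of the number of marked edges is a G-homotopy invariant, and that of
    P C P^-1 is that of C.  Varying A and B, it determines the images of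
    {1..i-1} and of {i,i+1,i+2} under the vertices of C.  Hence if C1 and C2 are
    equivalent then gamma1 = sigma1 u where u stabilizes these two sets;
    minimality of the path rules out inversions of u inside {i,i+1,i+2}, and
    sorting u by adjacent transpositions only uses letters disjoint from s_i
    and s_(i+1).  Conversely, a disjoint letter translates C along an edge. *)

Set Implicit Arguments.
Unset Strict Implicit.
Unset Printing Implicit Defensive.

(** * Loops and G-homotopies in an arbitrary graph *)

Section Homotopy.
Variable G : sgraph.
Implicit Types (x y v : G) (s t : seq G) (f g h : nat -> G).

Definition wadj : rel G := fun x y => (x == y) || adj x y.

Lemma wadjP x y : reflect (x = y \/ adj x y) (wadj x y).
Proof. by apply: (iffP orP) => -[/eqP|]; auto. Qed.

Lemma wadjxx x : wadj x x.
Proof. by rewrite /wadj eqxx. Qed.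

Lemma wadj_sym : symmetric wadj.
Proof. by move=> x y; rewrite /wadj eq_sym adj_sym. Qed.

Lemma adj_wadj x y : adj x y -> wadj x y.
Proof. by rewrite /wadj orbC => ->. Qed.

Lemma path_inf_mapP f :
  @graph_map path_inf G f <-> forall r, wadj (f r) (f r.+1).
Proof.
split=> [fG r | fG r q].
  by apply/wadjP/fG; rewrite /= /nat_adj eqxx.
by case/orP=> /eqP->; apply/wadjP; rewrite // wadj_sym.
Qed.

(** An edge of the box product is either horizontal or vertical: horizontal edges say that each row
    is a graph map, vertical ones that consecutive rows are pointwise equal or adjacent. Rows
    indexed by [nat] make stacking and induction easier. *)
Lemma G_homotopicP v f g :
  G_homotopic v f g <->
  exists (m : nat) (h : nat -> nat -> G),
    [/\ h 0 =1 f, h m =1 g, forall j, j <= m -> loop v (h j) &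
        forall j r, j < m -> wadj (h j r) (h j.+1 r)].
Proof.
split=> [[m [F [FG F0 Fm Floop]]] | [m [h [h0 hm hloop hadj]]]].
  exists m, (fun j r => F (r, inord j)); split=> [r|r|j lejm|j r ltjm].
  - rewrite -F0; congr (F (r, _)); apply: val_inj; exact: inordK.
  - rewrite -Fm; congr (F (r, _)); apply: val_inj; exact: inordK.
  - exact: Floop.
  - apply/wadjP/FG; rewrite /= /box_adj /= eqxx /nat_adj.
    by rewrite !inordK ?eqxx // ltnS // ltnW.
exists m, (fun x : nat * 'I_m.+1 => h x.2 x.1); split=> //= [|j]; last first.
  by apply: hloop; rewrite -ltnS.
have hadj' r (j k : 'I_m.+1) : k = j.+1 :> nat -> wadj (h j r) (h k r).
  by move=> Dk; rewrite Dk hadj // -ltnS -Dk.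
case=> [r j] [q k] /orP[] /= /andP[].
  by move=> /eqP-> /orP[] /eqP/hadj' jk; apply/wadjP; rewrite // wadj_sym.
move=> rq /eqP->; have [hG _ _] : loop v (h k) by apply: hloop; rewrite -ltnS.
exact: hG.
Qed.

Lemma G_homotopic_trans v f g h :
  G_homotopic v f g -> G_homotopic v g h -> G_homotopic v f h.
Proof.
move=> /G_homotopicP[m [F [F0 Fm Fl Fa]]] /G_homotopicP[k [H [H0 Hk Hl Ha]]].
apply/G_homotopicP; exists (m + k), (fun j => if j < m then F j else H (j - m)).
split=> [r | r | j lej | j r ltj].
- by case: posnP => [m0 | //]; rewrite sub0n H0 -Fm m0 F0.
- by rewrite ltnNge leq_addr /= addKn Hk.
- by case: ltnP => jm; [apply/Fl/ltnW | apply: Hl; lia].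
have [jm | mj] := ltnP j m; last by rewrite ltnNge leqW //= subSn // Ha //; lia.
case: ltnP => [_|mj]; first exact: Fa.
(* At the seam, row [m] is taken from [H], whose row 0 agrees with row [m] of [F]. *)
have Dm : m = j.+1 by lia.
by have := Fa j r jm; rewrite -Dm subnn H0 Fm.
Qed.

Lemma G_homotopic1 v f g :
  loop v f -> loop v g -> (forall r, wadj (f r) (g r)) -> G_homotopic v f g.
Proof.
move=> fl gl fg; apply/G_homotopicP; exists 1, (fun j => if j is 0 then f else g).
by split=> // -[].
Qed.

(** This compares a walk with itself delayed by one step. Past the end both sides take the default
    value [v], hence the condition on the last vertex. *)
Lemma wadj_nth v x s r :
  path wadj x s -> last x s = v -> wadj (nth v (x :: s) r) (nth v s r).
Proof.
elim: s x r => [|y s IHs] x [|r] /=.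
- by move=> _ ->; apply: wadjxx.
- by rewrite !nth_nil wadjxx.
- by case/andP.
- by case/andP => _; apply: IHs.
Qed.

Lemma loop_of_walkP v s :
  path wadj v s -> last v s = v -> loop v (loop_of_walk v s).
Proof.
move=> vs lvs; split=> //.
  by apply/path_inf_mapP => r; apply: wadj_nth.
by exists (size (v :: s)) => r ler; rewrite /loop_of_walk nth_default.
Qed.

(** Before the pause the two loops agree; after it, one is the other delayed by one step. *)
Lemma homotopic_pause v s t :
  path wadj v (s ++ t) -> last v (s ++ t) = v ->
  G_homotopic v (loop_of_walk v (s ++ t))
                (loop_of_walk v (s ++ last v s :: t)).
Proof.
move=> vst lst; have := vst; rewrite cat_path => /andP[vs st].
apply: G_homotopic1; first exact: loop_of_walkP.
  apply: loop_of_walkP; first by rewrite cat_path vs /= wadjxx.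
  by move: lst; rewrite !last_cat.
move=> r; rewrite /loop_of_walk -!cat_cons !nth_cat.
case: ltnP => _; first exact: wadjxx.
by rewrite wadj_sym wadj_nth // -last_cat.
Qed.

Lemma homotopic_all2 v s t :
  path wadj v s -> last v s = v -> path wadj v t -> last v t = v ->
  all2 wadj s t -> G_homotopic v (loop_of_walk v s) (loop_of_walk v t).
Proof.
move=> vs ls vt lt st; apply: G_homotopic1; try exact: loop_of_walkP.
case=> [|r]; rewrite /loop_of_walk /= ?wadjxx //.
elim: s t r st {vs ls vt lt} => [|x s IHs] [|y t] [|r] //=; rewrite ?nth_nil ?wadjxx //.
  by case/andP.
by case/andP => _; apply: IHs.
Qed.

Lemma path_adj_wadj x s : path (@adj G) x s -> path wadj x s.
Proof. by apply: sub_path => ? ?; apply: adj_wadj. Qed.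

Lemma last_rev_belast x s : last (last x s) (rev (belast x s)) = x.
Proof. by case: s => //= y s; rewrite rev_cons last_rcons. Qed.

Lemma lasso_path v s c :
  path wadj v s -> path wadj (last v s) c -> last (last v s) c = last v s ->
  path wadj v (lasso v s c).
Proof.
move=> vs sc lc; rewrite /lasso !cat_path vs sc lc rev_path.
by rewrite (eq_path (e' := wadj)) // => x y; rewrite wadj_sym.
Qed.

Lemma last_lasso v s c :
  last (last v s) c = last v s -> last v (lasso v s c) = v.
Proof. by move=> lc; rewrite /lasso !last_cat lc last_rev_belast. Qed.

(* Pausing before and after c brings the two loops into step. *)
Lemma homotopic_translate v s y c d :
  path wadj v s -> path wadj (last v s) c -> last (last v s) c = last v s ->
  wadj (last v s) y -> path wadj y d -> last y d = y -> all2 wadj c d ->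
  G_homotopic v (loop_of_walk v (lasso v s c))
                (loop_of_walk v (lasso v (rcons s y) d)).
Proof.
move=> vs sc lc sy yd ld cd; set x := last v s in sc lc sy.
have Dd : lasso v (rcons s y) d = s ++ y :: d ++ x :: rev (belast v s).
  by rewrite /lasso belast_rcons lastI rev_rcons -/x cat_rcons.
have d_path : path wadj v (lasso v (rcons s y) d).
  by rewrite lasso_path ?rcons_path ?vs ?last_rcons.
have d_last : last v (lasso v (rcons s y) d) = v.
  by rewrite last_lasso ?last_rcons.
have rev_ok : path wadj x (rev (belast v s)).
  by rewrite rev_path (eq_path (e' := wadj)) // => ? ?; rewrite wadj_sym.
have c_path := lasso_path vs sc lc; have c_last := last_lasso lc.
apply: G_homotopic_trans (homotopic_pause c_path c_last) _; rewrite -/x.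
set r := rev (belast v s) in rev_ok *.
have xr : last x r = v by apply: last_rev_belast.
have E2 : s ++ x :: c ++ r = (s ++ x :: c) ++ r by rewrite -catA.
have lE : last v (s ++ x :: c) = x by rewrite last_cat.
have path2 : path wadj v ((s ++ x :: c) ++ r).
  by rewrite cat_path lE rev_ok cat_path /= vs wadjxx sc.
have last2 : last v ((s ++ x :: c) ++ r) = v by rewrite last_cat lE.
rewrite E2; apply: G_homotopic_trans (homotopic_pause path2 last2) _.
rewrite lE; apply: homotopic_all2 => //.
- by rewrite cat_path lE /= wadjxx rev_ok cat_path /= vs wadjxx sc.
- by rewrite last_cat lE.
have all2_wadj_cat s1 t1 s2 t2 :
    all2 wadj s1 t1 -> all2 wadj s2 t2 -> all2 wadj (s1 ++ s2) (t1 ++ t2).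
  by elim: s1 t1 => [|a s1 IHs] [|b t1] //= /andP[-> /IHs]; apply.
have wrefl t : all2 wadj t t by elim: t => //= z t ->; rewrite wadjxx.
rewrite Dd -catA; apply: (all2_wadj_cat _ _ _ _ (wrefl s)).
rewrite /= sy all2_wadj_cat //= wadjxx; exact: wrefl.
Qed.

(** * The parity of marked edges as a homotopy invariant *)

Section Parity.
Variable e : rel G.
Hypotheses (e_sym : symmetric e) (e_irr : irreflexive e).
(** The sides may be constant, as in the cells of a homotopy. *)
Hypothesis e_square : forall x y x' y',
  wadj x y -> wadj y y' -> wadj x x' -> wadj x' y' ->
  e x y (+) e y y' = e x x' (+) e x' y'.

(** Loops are infinite sequences, so the count stops at [N]; once the loop is constant, a larger [N]
    adds nothing because [e] is irreflexive. *)
Definition parity f N := \big[addb/false]_(r < N) e (f r) (f r.+1).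

Fixpoint walk_parity x s :=
  if s is y :: s' then e x y (+) walk_parity y s' else false.

Lemma walk_parity_cat x s t :
  walk_parity x (s ++ t) = walk_parity x s (+) walk_parity (last x s) t.
Proof. by elim: s x => //= y s IHs x; rewrite IHs addbA. Qed.

Lemma walk_parity_rev x s :
  walk_parity (last x s) (rev (belast x s)) = walk_parity x s.
Proof.
elim: s x => //= y s IHs x.
rewrite rev_cons -cats1 walk_parity_cat IHs last_rev_belast /= addbF.
by rewrite addbC e_sym.
Qed.

(** The way back crosses the marked edges of [s] a second time, which cancels them. *)
Lemma walk_parity_lasso v s c :
  last (last v s) c = last v s ->
  walk_parity v (lasso v s c) = walk_parity (last v s) c.
Proof.
move=> lc; rewrite /lasso !walk_parity_cat lc walk_parity_rev.
by rewrite addbC -addbA addbb addbF.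
Qed.

Lemma parity_walk v s N :
  last v s = v -> size s <= N -> parity (loop_of_walk v s) N = walk_parity v s.
Proof.
rewrite /parity /loop_of_walk.
(* The starting vertex is generalized, while the default value of [nth] remains [v]. *)
suff Dpar x : last x s = v -> size s <= N ->
    \big[addb/false]_(r < N) e (nth v (x :: s) r) (nth v (x :: s) r.+1) =
    walk_parity x s by apply: Dpar.
elim: s N x => [|y s IHs] [|N] x //= ls leN; first by rewrite big_ord0.
  by rewrite big1 // ls => -[[|r] _] _ //=; rewrite ?nth_nil e_irr.
by rewrite big_ord_recl /=; congr (_ (+) _); apply: IHs.
Qed.

Lemma parity_homotopic v f g :
  G_homotopic v f g -> exists N0, forall N, N0 <= N -> parity f N = parity g N.
Proof.
case/G_homotopicP=> m [h [h0 hm hl ha]].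
have eq_parity f1 f2 N : f1 =1 f2 -> parity f1 N = parity f2 N.
  by move=> f12; apply: eq_bigr => r _; rewrite !f12.
suff [N0 hN]: exists N0, forall N, N0 <= N -> parity (h 0) N = parity (h m) N.
  by exists N0 => N /hN; rewrite (eq_parity _ _ _ h0) (eq_parity _ _ _ hm).
elim: m {hm} hl ha => [|m IHm] hl ha; first by exists 0.
have [||N0 IH] := IHm; [by move=> j lej; apply/hl/leqW |
                        by move=> j r ltj; apply/ha/leqW |].
have [[hG h00 [N1 hN1]] [kG k0 [N2 kN2]]] := (hl m (leqnSn m), hl m.+1 (leqnn _)).
exists (N0 + N1 + N2) => N leN; rewrite IH; last by lia.
(* The strip between two consecutive rows is filled square by square. Its left side is constant at
   [v], and so is its right side once [N] is large. *)
have E : parity (h m) N (+) e (h m N) (h m.+1 N) = parity (h m.+1) N.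
  elim: N {leN} => [|N IHN]; first by rewrite /parity !big_ord0 h00 k0 e_irr.
  rewrite {2}/parity big_ord_recr -/(parity _ _) /= -IHN.
  rewrite /parity big_ord_recr -/(parity _ _) /= -!addbA; congr (_ (+) _).
  by apply: e_square; do ?[exact: ha]; [move/path_inf_mapP: hG | move/path_inf_mapP: kG].
by move: E; rewrite hN1 ?kN2 ?e_irr ?addbF //; lia.
Qed.

Lemma lasso_parity_homotopic v s t c d :
  last (last v s) c = last v s -> last (last v t) d = last v t ->
  G_homotopic v (loop_of_walk v (lasso v s c)) (loop_of_walk v (lasso v t d)) ->
  walk_parity (last v s) c = walk_parity (last v t) d.
Proof.
move=> lc ld /parity_homotopic[N0 eqN].
have := eqN (N0 + size (lasso v s c) + size (lasso v t d)).
rewrite !parity_walk ?last_lasso // ?walk_parity_lasso //; lia.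
Qed.

End Parity.
End Homotopy.

Import GroupScope.

(** * Simple transpositions, inversions and distances in the permutahedron *)

Section Permutations.
Variable n : nat.
Implicit Types (i j k : 'I_n.-1) (x y z u w : 'S_n) (a b : 'I_n).

Definition lo j : 'I_n := Ordinal (ltnW (simple_subproof j)).
Definition hi j : 'I_n := Ordinal (simple_subproof j).

Lemma perm_compE x y a : (x ∘ y) a = x (y a).
Proof. by rewrite /perm_comp permM. Qed.

Lemma perm_compA x y z : x ∘ (y ∘ z) = x ∘ y ∘ z.
Proof. by rewrite /perm_comp mulgA. Qed.

Lemma perm_comp1 x : x ∘ 1 = x.
Proof. by rewrite /perm_comp mul1g. Qed.

Lemma perm_comp_simpleK x j : x ∘ simple j ∘ simple j = x.
Proof. by rewrite /perm_comp mulgA tperm2 mul1g. Qed.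

Lemma val_simple j a :
  simple j a = (if a == j :> nat then j.+1
                else if a == j.+1 :> nat then j : nat else a) :> nat.
Proof.
rewrite /simple; case: tpermP => [->|->|] /=; first by rewrite eqxx.
  by rewrite gtn_eqF // eqxx.
by move=> /eqP; rewrite -val_eqE /= => /negPf-> /eqP; rewrite -val_eqE /= => /negPf->.
Qed.

Lemma odd_simple j : odd_perm (simple j) = true.
Proof. by rewrite odd_tperm -val_eqE /= neq_ltn ltnSn. Qed.

Lemma simple_lo j : simple j (lo j) = hi j. Proof. exact: tpermL. Qed.
Lemma simple_hi j : simple j (hi j) = lo j. Proof. exact: tpermR. Qed.

Lemma disjoint_comm x y : disjoint_perm x y -> x ∘ y = y ∘ x.
Proof.
move=> dxy; apply/permP => a; rewrite !perm_compE.
have [xa|nxa] := eqVneq (x a) a; last first.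
  have fixy c : x c != c -> y c = c.
    by move=> xc; apply/eqP/negPn/negP => yc; case: (dxy c).
  by rewrite (fixy a nxa) fixy // (inj_eq perm_inj).
rewrite xa; apply/eqP/negPn/negP => xya.
by apply: (dxy (y a)); split=> //; apply: contra xya => /eqP/perm_inj->; rewrite xa.
Qed.

Lemma disjoint_simple i j :
  (j.+1 < i) || (i.+1 < j) -> disjoint_perm (simple j) (simple i).
Proof.
by move=> ij a; rewrite -!val_eqE /= !val_simple => -[]; do !case: eqP; lia.
Qed.

Definition inversions u := [set p : 'I_n * 'I_n | (p.1 < p.2) && (u p.2 < u p.1)].
Definition inv u := #|inversions u|.

Lemma inv1 : inv 1 = 0.
Proof.
apply/eqP; rewrite cards_eq0; apply/eqP/setP => -[a b].
by rewrite !inE !perm1; apply/negP => /andP[/ltnW]; rewrite leqNgt => /negP.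
Qed.

Lemma simple_ltn j a b : (a, b) != (lo j, hi j) -> a < b -> simple j a < simple j b.
Proof.
rewrite xpair_eqE -!val_eqE /= !val_simple.
by do !case: eqP => //=; lia.
Qed.

(** [simple j] keeps the order of every pair of positions except the two consecutive ones that it
    exchanges, so it carries the other inversions bijectively. *)
Lemma inversions_simple u j :
  inversions (u ∘ simple j) :\ (lo j, hi j) =
  [set (simple j p.1, simple j p.2) | p in inversions u :\ (lo j, hi j)].
Proof.
have simpleK : involutive (simple j) by apply: tpermK.
have sub x y : (forall a, x (simple j a) = y a) ->
    forall p, p \in inversions x :\ (lo j, hi j) ->
    (simple j p.1, simple j p.2) \in inversions y :\ (lo j, hi j).
  move=> xy [a b]; rewrite !inE /= -!xy !simpleK => /and3P[ab lt_ab ->].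
  rewrite simple_ltn // !andbT; apply: contraL lt_ab => /eqP[Da Db].
  rewrite -leqNgt -(simpleK a) -(simpleK b) Da Db simple_lo simple_hi /=.
  exact: leqnSn.
apply/setP => p; apply/idP/imsetP => [/(sub _ u) Ip | [q Iq ->]].
  exists (simple j p.1, simple j p.2); last by rewrite /= !simpleK; case: p {Ip}.
  by apply: Ip => a; rewrite perm_compE simpleK.
by apply: (sub u) => // a; rewrite perm_compE.
Qed.

Lemma inv_simple_card u j :
  #|inversions (u ∘ simple j) :\ (lo j, hi j)| = #|inversions u :\ (lo j, hi j)|.
Proof.
by rewrite inversions_simple card_imset // => -[a b] [c d] [/perm_inj-> /perm_inj->].
Qed.

Lemma inv_descent u j : u (hi j) < u (lo j) -> inv u = (inv (u ∘ simple j)).+1.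
Proof.
move=> desc; rewrite /inv (cardsD1 (lo j, hi j)) inE /= ltnSn desc /=.
rewrite -inv_simple_card [in RHS](cardsD1 (lo j, hi j)) inE /=.
by rewrite !perm_compE simple_lo simple_hi ltnSn ltnNge (ltnW desc).
Qed.

Lemma inv_simple_leq u j : inv (u ∘ simple j) <= (inv u).+1.
Proof.
rewrite /inv (cardsD1 (lo j, hi j)) inv_simple_card (cardsD1 (lo j, hi j) (inversions u)).
by do !case: (_ \in _); rewrite ?add0n ?add1n ?ltnS ?leqW.
Qed.

Lemma increasing_geq u : (forall a b, a < b -> u a < u b) -> forall a, a <= u a.
Proof.
move=> incr; suff: forall m a, a = m :> nat -> m <= u a by move=> H a; apply: H.
elim=> // m IHm a Da; have lt_mn : m < n by rewrite (leq_trans _ (ltn_ord a)) ?Da.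
by apply: leq_ltn_trans (IHm (Ordinal lt_mn) erefl) _; rewrite incr //= Da.
Qed.

(** Both [u] and its inverse are increasing, hence neither lowers any point. *)
Lemma no_descent u : (forall j, u (lo j) < u (hi j)) -> u = 1.
Proof.
move=> asc; have incr a b : a < b -> u a < u b.
  have: forall m b, b = m :> nat -> a < m -> u a < u b; last exact.
  elim=> // m IHm c Dc; rewrite ltnS leq_eqVlt => lt_am.
  have lt_mn : m < n.-1 by have := ltn_ord c; lia.
  have Dhi : c = hi (Ordinal lt_mn) by apply: val_inj.
  rewrite Dhi; apply: leq_ltn_trans _ (asc _).
  case/orP: lt_am => [/eqP Da | /IHm/ltnW-> //].
  by rewrite leq_eqVlt; apply/orP/or_introl/eqP; congr (val (u _)); apply: val_inj.
have incrV a b : a < b -> u^-1 a < u^-1 b.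
  move=> ab; rewrite ltnNge leq_eqVlt; apply/negP => /orP[/eqP/val_inj/perm_inj Eab|].
    by rewrite Eab ltnn in ab.
  by move/incr; rewrite !permKV ltnNge (ltnW ab).
apply/permP => a; apply: val_inj; apply/eqP; rewrite perm1 eqn_leq.
by rewrite (increasing_geq incr) -{2}[a](permK u) (increasing_geq incrV).
Qed.

Lemma descentP u : u != 1 -> exists j, u (hi j) < u (lo j).
Proof.
move=> u1; apply/existsP; apply: contraNT u1 => /existsPn ndesc.
apply/eqP/no_descent => j; rewrite ltn_neqAle leqNgt ndesc andbT val_eqE.
by rewrite (inj_eq perm_inj) -val_eqE /= neq_ltn ltnSn.
Qed.

(** Bubble sort as an induction principle: each descent removed on the right lowers the number of
    inversions by one. *)
Lemma descent_ind (Q : 'S_n -> Prop) :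
  Q 1 -> (forall u j, u (hi j) < u (lo j) -> Q (u ∘ simple j) -> Q u) ->
  forall u, Q u.
Proof.
move=> Q1 Qdesc u; have [m] := ubnP (inv u); elim: m u => // m IHm u.
have [-> //|/descentP[j desc]] := eqVneq u 1.
by rewrite (inv_descent desc) ltnS => /IHm; apply: Qdesc.
Qed.

Lemma permutahedron_adjP x y :
  reflect (exists j, y = x ∘ simple j) (permutahedron_adj x y).
Proof.
by rewrite permutahedron_adj_sym; apply: (iffP existsP) => -[j Dy]; exists j; apply/eqP.
Qed.

(** The letters that sort [u], in reverse order, label the path. By [inv_shortest] below, no path
    between these ends is shorter. *)
Lemma permutahedron_path x u :
  exists q, [/\ path (@permutahedron_adj n) x q, last x q = x ∘ u & size q = inv u].
Proof.
elim/descent_ind: u => [|u j desc [q [xq lq sq]]].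
  by exists [::]; rewrite perm_comp1 inv1.
exists (rcons q (x ∘ u)); rewrite rcons_path last_rcons size_rcons xq lq sq.
split=> //; last by rewrite (inv_descent desc).
by apply/permutahedron_adjP; exists j; rewrite perm_compA perm_comp_simpleK.
Qed.

Lemma permutahedron_connected x y :
  exists2 q, path (@permutahedron_adj n) x q & last x q = y.
Proof.
have [q [xq lq _]] := permutahedron_path x (x^-1 ∘ y).
by exists q; rewrite // lq perm_compA /perm_comp mulVg mulg1.
Qed.

(** Each edge multiplies by a simple transposition on the right, adding at most one inversion. The
    left factor [w] allows the start to be moved to the identity. *)
Lemma inv_path w x q :
  path (@permutahedron_adj n) x q -> inv (w ∘ last x q) <= inv (w ∘ x) + size q.
Proof.
elim: q x => [|y q IHq] x /=; first by rewrite addn0.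
case/andP=> /permutahedron_adjP[j Dy] /IHq /leq_trans-> //.
by rewrite addnS -addSn leq_add2r Dy perm_compA inv_simple_leq.
Qed.

Lemma inv_shortest x u q :
  path (@permutahedron_adj n) x q -> last x q = x ∘ u -> inv u <= size q.
Proof.
move=> xq lq; have := inv_path x^-1 xq.
by rewrite lq perm_compA /perm_comp mulgV inv1 mulg1.
Qed.

End Permutations.

(** * Squares of the permutahedron and marked edges *)

Lemma simple_inj n : injective (@simple n).
Proof.
move=> i j /(congr1 (fun u : 'S_n => u (lo i) : nat)).
rewrite !val_simple /= eqxx => Eij; apply: val_inj => /=.
by move: Eij; do !case: eqP; lia.
Qed.

(* The right descents of s_i s_b are b and, if the factors commute, i;
   d is one of them. *)
Lemma simple_square n (i b c d : 'I_n.-1) :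
  b != i -> c != i -> simple i ∘ simple b = simple c ∘ simple d ->
  [/\ d = i, c = b & (b.+1 < i) || (i.+1 < b)].
Proof.
move=> bi ci E; have [Ecd|cd] := eqVneq c d.
  case/eqP: bi; apply: simple_inj; apply: (mulIg (simple i)).
  by move: E; rewrite /perm_comp Ecd /simple !tperm2.
have desc : simple i (simple b (hi d)) < simple i (simple b (lo d)).
  rewrite -!(perm_compE (simple i)) E !perm_compE simple_lo simple_hi.
  by apply: simple_ltn; rewrite // xpair_eqE -!val_eqE /= eqSS andbb eq_sym.
have [Ebd|bd] := eqVneq d b.
  case/eqP: ci; apply: simple_inj; apply: (mulgI (simple d)).
  by move: E; rewrite /perm_comp Ebd.
have [Di far] : d = i /\ (b.+1 < i) || (i.+1 < b).
  have [] : d = i :> nat /\ (b.+1 < i) || (i.+1 < b); last by move=> /val_inj.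
  move: desc bi bd; rewrite -!val_eqE /= !val_simple /= => desc bi bd.
  by move: desc; do !(case: eqP => //=; try lia).
split=> //; apply: simple_inj; apply: (mulgI (simple d)).
move: E; rewrite /perm_comp Di => <-.
by have := disjoint_comm (disjoint_simple far); rewrite /perm_comp.
Qed.

Section MarkedEdges.
Variable n : nat.
Implicit Types (i j k : 'I_n.-1) (x y z u w : 'S_n) (a b : 'I_n).
Implicit Types (A B : {set 'I_n}).

Definition below i := [set a : 'I_n | a < i].
(** The positions moved by $s_i$ and $s_{i+1}$ together. *)
Definition block i := [set a : 'I_n | (i <= a) && (a <= i.+2)].

Lemma imset_comp_perm x y A : (x ∘ y) @: A = x @: (y @: A).
Proof. by rewrite -imset_comp; apply: eq_imset => a; rewrite perm_compE. Qed.

Lemma perm_imset_subset x A : {subset x @: A <= A} -> x @: A = A.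
Proof.
move=> xA; apply/eqP; rewrite eqEcard card_imset ?leqnn ?andbT; last exact: perm_inj.
exact/subsetP.
Qed.

Lemma simple_below i j : j.+1 != i -> simple j @: below i = below i.
Proof.
move=> ji; apply: perm_imset_subset => _ /imsetP[a ai ->]; move: ai ji.
by rewrite !inE val_simple; do !case: eqP; lia.
Qed.

Lemma simple_pair i j : (j.+1 < i) || (i.+1 < j) ->
  simple j @: [set lo i; hi i] = [set lo i; hi i].
Proof.
move=> far; have fix_simple a : a \in [set lo i; hi i] -> simple j a = a.
  move=> ai; apply: val_inj; move: ai; rewrite /= val_simple !inE -!val_eqE /=.
  by do !case: eqP; lia.
by rewrite -[RHS]imset_id; apply: eq_in_imset.
Qed.

Lemma simple_pair_self i : simple i @: [set lo i; hi i] = [set lo i; hi i].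
Proof. by rewrite imsetU1 imset_set1 simple_lo simple_hi setUC. Qed.

Definition marked i A B : rel (permutahedron n) := fun x y =>
  [&& y == x ∘ simple i, x @: below i == A & x @: [set lo i; hi i] == B].

Variables (i : 'I_n.-1) (A B : {set 'I_n}).
Let e := marked i A B.

Lemma marked_simple x j : e x (x ∘ simple j) =
  [&& j == i, x @: below i == A & x @: [set lo i; hi i] == B].
Proof.
rewrite /e /marked /perm_comp (can_eq (mulgK x)); congr (_ && _).
exact: (inj_eq (@simple_inj n)).
Qed.

(** [simple i] preserves [below i] and the pair of positions that it exchanges, so both ends of an
    edge satisfy the same conditions. *)
Lemma marked_sym : symmetric e.
Proof.
suff half x y : e x y -> e y x by move=> x y; apply/idP/idP; apply: half.
case/and3P=> /eqP-> xA xB; apply/and3P; split.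
- by rewrite perm_comp_simpleK.
- by rewrite imset_comp_perm simple_below // neq_ltn ltnSn orbT.
- by rewrite imset_comp_perm simple_pair_self.
Qed.

Lemma marked_irr : irreflexive e.
Proof.
move=> x; apply/negbTE/negP => /andP[/eqP Dx _].
have: adj (x : permutahedron n) x by apply/permutahedron_adjP; exists i.
by rewrite adj_irr.
Qed.

Lemma odd_permutahedron_adj x y :
  permutahedron_adj x y -> odd_perm y = ~~ odd_perm x.
Proof. by case/permutahedron_adjP=> j ->; rewrite /perm_comp odd_permM odd_simple. Qed.

(** By [simple_square] the opposite edge is also labeled by [i], and its ends arise from [x] and [y]
    by a transposition far from [i], which preserves both sets of positions. *)
Lemma marked_square_sub x y x' y' :
  permutahedron_adj x y -> permutahedron_adj y y' ->
  permutahedron_adj x x' -> permutahedron_adj x' y' ->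
  x != y' -> y != x' -> e x y -> e x' y'.
Proof.
move=> _ /permutahedron_adjP[b ->] /permutahedron_adjP[c ->].
move=> /permutahedron_adjP[d E] xy' yx' /and3P[/eqP Dy xA xB].
rewrite {y}Dy in E xy' yx' *.
(* The two inequalities between vertices say that labels of consecutive edges differ at [y] and at
   [x]. *)
have bi : b != i by apply: contraNneq xy' => ->; rewrite perm_comp_simpleK.
have ci : c != i by apply: contraNneq yx' => ->.
move: E; rewrite -!perm_compA => E; have E' : simple i ∘ simple b = simple c ∘ simple d.
  by apply: (mulIg x); move: E; rewrite /perm_comp.
have [Dd Dc far] := simple_square bi ci E'.
rewrite E perm_compA Dd marked_simple eqxx Dc !imset_comp_perm.
rewrite simple_below ?simple_pair ?xA //.
by rewrite neq_ltn; case/orP: far => [-> //|]; lia.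
Qed.

Lemma marked_square_eq x y x' y' :
  permutahedron_adj x y -> permutahedron_adj y y' ->
  permutahedron_adj x x' -> permutahedron_adj x' y' ->
  x != y' -> y != x' -> e x y = e x' y'.
Proof.
move=> xy yy' xx' x'y' nxy' nyx'; apply/idP/idP; first exact: marked_square_sub.
by apply: marked_square_sub; rewrite // 1?eq_sym // permutahedron_adj_sym.
Qed.

(** Some side is constant: the sign of a permutation makes the graph bipartite, so there is no
    genuine triangle. *)
Lemma marked_triangle (x y z : permutahedron n) :
  wadj x y -> wadj y z -> wadj x z -> e x y (+) e y z = e x z.
Proof.
case/orP=> [/eqP-> *|xy]; first by rewrite marked_irr.
case/orP=> [/eqP-> *|yz]; first by rewrite marked_irr addbF.
case/orP=> [/eqP-> *|xz]; first by rewrite marked_irr (marked_sym y) addbb.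
have := odd_permutahedron_adj xz; rewrite (odd_permutahedron_adj yz).
by rewrite (odd_permutahedron_adj xy); case: odd_perm.
Qed.

(** If opposite corners coincide, the terms cancel or match; a constant side leaves a triangle; in a
    genuine square opposite edges have equal marks. *)
Lemma marked_square (x y x' y' : permutahedron n) :
  wadj x y -> wadj y y' -> wadj x x' -> wadj x' y' ->
  e x y (+) e y y' = e x x' (+) e x' y'.
Proof.
move=> wxy wyy' wxx' wx'y'.
have [Exy'|nxy'] := eqVneq x y'.
  by rewrite Exy' (marked_sym y) (marked_sym x') !addbb.
have [Eyx'|nyx'] := eqVneq y x'; first by rewrite Eyx'.
case/orP: (wxy) => [/eqP Exy|xy].
  by subst y; rewrite marked_irr marked_triangle.
case/orP: (wyy') => [/eqP Eyy'|yy'].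
  by subst y'; rewrite marked_irr addbF -(marked_triangle wxx' wx'y').
case/orP: (wxx') => [/eqP Exx'|xx'].
  by subst x'; rewrite marked_irr (marked_triangle wxy wyy').
case/orP: (wx'y') => [/eqP Ex'y'|x'y'].
  by subst x'; rewrite marked_irr addbF (marked_triangle wxy wyy').
rewrite (@marked_square_eq x y x' y') // addbC; congr (_ (+) _).
rewrite marked_sym (marked_sym x).
by apply: marked_square_eq; rewrite // 1?eq_sym // permutahedron_adj_sym.
Qed.

Variable i' : 'I_n.-1.
Hypothesis Di' : i' = i.+1 :> nat.

Definition third := hi i'.

Lemma lo_succ : lo i' = hi i. Proof. exact: val_inj. Qed.

(** Only the three edges labeled by [i] can be marked. When they are crossed, the positions [lo i]
    and [hi i] carry in turn the three pairs of values of [x] on the block. *)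
Lemma walk_parity_around x :
  walk_parity e x [seq around i i' x m | m <- iota 1 6] =
  (x @: below i == A) &&
  ((x @: [set lo i; hi i] == B) (+) (x @: [set hi i; third] == B)
     (+) (x @: [set lo i; third] == B)).
Proof.
have ni' : (i' == i) = false by rewrite -val_eqE /= Di' gtn_eqF.
have ab_below : simple i @: below i = below i /\ simple i' @: below i = below i.
  by split; apply: simple_below; rewrite ?Di' neq_ltn ?leqnSn ?ltnS ?orbT //; lia.
case: ab_below => aL bL.
have i'_lo : simple i' (lo i) = lo i.
  by apply: val_inj; rewrite /= val_simple /= Di'; do !case: eqP; lia.
have i_third : simple i third = third.
  by apply: val_inj; rewrite /= val_simple /= Di'; do !case: eqP; lia.
have i'_hi : simple i' (hi i) = third by rewrite -lo_succ simple_lo.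
have i'_third : simple i' third = hi i by rewrite simple_hi lo_succ.
rewrite /= !marked_simple !eqxx !ni' /= !imset_comp_perm !(aL, bL).
rewrite !(imsetU1, imset_set1).
rewrite !(lo_succ, simple_lo, simple_hi, i'_lo, i'_hi, i_third, i'_third).
rewrite (setUC [set x third]).
by case: (_ == A); rewrite /= ?addbF ?addbA.
Qed.

End MarkedEdges.

(** * Primitive 6-cycles as cosets *)

Lemma ord_pred6_odd (k : 'I_6) : odd (ord_pred k) = ~~ odd k.
Proof. by case: k => [[|[|[|[|[|[|]]]]]]]. Qed.

Lemma iter_ordS6 (k l : 'I_6) : exists m, l = iter m (@ordS 6) k.
Proof.
have val_iter m : val (iter m (@ordS 6) k) = (k + m) %% 6.
  elim: m => [|m IHm] /=; first by rewrite addn0 modn_small.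
  by rewrite IHm; lia.
(* The summand 6 keeps the truncated subtraction exact. *)
exists (6 + l - k); apply: val_inj; rewrite val_iter subnKC; last first.
  by rewrite (leq_trans (ltnW (ltn_ord k))) ?leq_addr.
by rewrite addnC modnDr modn_small.
Qed.

Section PrimitiveCycle.
Variable n : nat.
Implicit Types (i j : 'I_n.-1) (x y : 'S_n) (C : subgraph 'S_n).

(** The edges leaving and entering a vertex of the cycle carry the two different labels. *)
Lemma primitive6_step i i' C x : primitive6 i i' C -> x \in sub_vertices C ->
  (x ∘ simple i \in sub_vertices C) /\ (x ∘ simple i' \in sub_vertices C).
Proof.
case=> _ [c [_ lab ->]] /imsetP[k _ ->] /=.
have fwd : c k ∘ simple (if odd k then i' else i) \in [set c l | l : 'I_6].
  by rewrite -(lab k) imset_f.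
have bwd : c k ∘ simple (if odd k then i else i') \in [set c l | l : 'I_6].
  have := lab (ord_pred k); rewrite ord_predK ord_pred6_odd => Dck.
  by rewrite {1}Dck if_neg perm_comp_simpleK imset_f.
by case: odd fwd bwd.
Qed.

(** Together with [primitive6_step], this identifies the vertex set with the coset of [x] modulo the
    subgroup generated by the two transpositions. *)
Lemma primitive6_ind i i' C x (Q : 'S_n -> Prop) : primitive6 i i' C ->
  x \in sub_vertices C -> Q x ->
  (forall y, Q y -> Q (y ∘ simple i) /\ Q (y ∘ simple i')) ->
  forall y, y \in sub_vertices C -> Q y.
Proof.
case=> _ [c [_ lab ->]] /imsetP[k _ ->] /= Qk Qstep _ /imsetP[l _ ->].
have [m ->] := iter_ordS6 k l; elim: m => //= m /Qstep[Qi Qi'].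
by rewrite lab; case: odd.
Qed.

(** The edge set is thus determined by the vertex set and the labels, independently of the
    enumeration of the cycle. *)
Lemma primitive6_edges i i' C f : primitive6 i i' C ->
  f \in sub_edges C <-> exists2 x, x \in sub_vertices C &
    f = [set x; x ∘ simple i] \/ f = [set x; x ∘ simple i'].
Proof.
case=> _ [c [_ lab ->]] /=; split=> [/imsetP[k _ ->] | [x /imsetP[k _ ->] Df]].
  by exists (c k); rewrite ?imset_f // lab; case: odd; auto.
have fwd : [set c k; c k ∘ simple (if odd k then i' else i)]
    \in [set [set c l; c (ordS l)] | l : 'I_6].
  by apply/imsetP; exists k; rewrite // lab.
have bwd : [set c k; c k ∘ simple (if odd k then i else i')]
    \in [set [set c l; c (ordS l)] | l : 'I_6].
  apply/imsetP; exists (ord_pred k); rewrite // ord_predK setUC.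
  have := lab (ord_pred k); rewrite ord_predK ord_pred6_odd => Dck.
  by rewrite {1}Dck if_neg perm_comp_simpleK.
by case: odd fwd bwd => fwd bwd; case: Df => ->.
Qed.

Lemma primitive6_eq i i' C D x : primitive6 i i' C -> primitive6 i i' D ->
  x \in sub_vertices C -> x \in sub_vertices D -> C = D.
Proof.
move=> pC pD xC xD.
have sub E F : primitive6 i i' E -> primitive6 i i' F ->
    x \in sub_vertices E -> x \in sub_vertices F ->
    {subset sub_vertices E <= sub_vertices F}.
  move=> pE pF xE xF; apply: (primitive6_ind pE xE) => // y.
  exact: primitive6_step.
have eqV : sub_vertices C = sub_vertices D.
  by apply/setP => y; apply/idP/idP; apply: sub.
have eqE : sub_edges C = sub_edges D.
  apply/setP => f; apply/idP/idP => /(primitive6_edges f) => H.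
    by apply/(primitive6_edges f pD); rewrite -eqV; apply: H.
  by apply/(primitive6_edges f pC); rewrite eqV; apply: H.
by case: C D eqV eqE {pC pD xC xD} => V E [V' E'] /= -> ->.
Qed.

Lemma primitive6_below i i' C x y : primitive6 i i' C ->
  x \in sub_vertices C -> y \in sub_vertices C -> x @: below i = y @: below i.
Proof.
move=> pC xC; have Di' : i' = i.+1 :> nat by case: pC.
move: y; apply: (primitive6_ind pC xC) => // y ->; rewrite !imset_comp_perm.
by rewrite !simple_below // ?Di'; lia.
Qed.

Lemma simple_block i j : j = i :> nat \/ j = i.+1 :> nat ->
  simple j @: block i = block i.
Proof.
move=> ji; apply: perm_imset_subset => _ /imsetP[a ai ->]; move: ai ji.
by rewrite !inE val_simple; do !case: eqP; lia.
Qed.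

Lemma primitive6_block i i' C x y : primitive6 i i' C ->
  x \in sub_vertices C -> y \in sub_vertices C -> x @: block i = y @: block i.
Proof.
move=> pC xC; have Di' : i' = i.+1 :> nat by case: pC.
move: y; apply: (primitive6_ind pC xC) => // y ->; rewrite !imset_comp_perm.
by rewrite !simple_block; auto.
Qed.

Lemma primitive6_vertex i i' C : primitive6 i i' C -> exists x, x \in sub_vertices C.
Proof. by case=> _ [c [_ _ ->]]; exists (c ord0); apply: imset_f. Qed.

(** [traversal] chooses its own pair of labels; this shows that the cycle leaves no choice. *)
Lemma primitive6_labels i i' j j' C : primitive6 i i' C -> primitive6 j j' C ->
  i = j /\ i' = j'.
Proof.
move=> pi pj; have [Di' Dj'] : i' = i.+1 :> nat /\ j' = j.+1 :> nat.
  by case: pi; case: pj.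
have [x xC] := primitive6_vertex pi.
(* All vertices of the cycle agree outside the block, so a transposition joining two of them moves
   only positions in the block. *)
have fix_out l : x ∘ simple l \in sub_vertices C ->
    forall a, a \notin block i -> simple l a = a.
  move=> + a.
  suff H : a \notin block i -> forall y, y \in sub_vertices C -> y a = x a.
    by move=> xlC /H/(_ _ xlC); rewrite perm_compE => /perm_inj.
  rewrite inE negb_and -!ltnNge => ai.
  apply: (primitive6_ind pi xC) => // z Dz; rewrite !perm_compE -Dz.
  by split; congr (z _); apply: val_inj; rewrite /= val_simple; do !case: eqP; lia.
have [/fix_out jout /fix_out j'out] := primitive6_step pj xC.
have lo_in : lo j \in block i.
  by apply/negPn/negP => /jout; rewrite simple_lo => /(congr1 val) /=; lia.
have hi_in : hi j' \in block i.
  by apply/negPn/negP => /j'out; rewrite simple_hi => /(congr1 val) /=; lia.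
(* Both $j$ and $j+2$ lie between $i$ and $i+2$. *)
move: lo_in hi_in; rewrite !inE /= => lo_in hi_in.
by split; apply: val_inj => /=; lia.
Qed.

(** The closing of the cycle at one vertex gives the relation $(s_is_{i+1})^3=1$, which then applies
    at any [x]. *)
Lemma around6 i i' C x : primitive6 i i' C -> around i i' x 6 = x.
Proof.
case=> _ [c [_ lab _]]; have := lab ord_max; rewrite /= /edge_label.
have ord6 m (lt : m.+1 < 6) : c (Ordinal lt) =
    c (Ordinal (ltnW lt)) ∘ simple (if odd m then i' else i).
  by rewrite -(lab (Ordinal (ltnW lt))); congr c; apply: val_inj; rewrite /= modn_small.
have -> : ordS (ord_max : 'I_6) = ord0 by apply: val_inj.
have -> : (ord_max : 'I_6) = Ordinal (isT : 5 < 6) by apply: val_inj.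
rewrite !ord6 /= (_ : Ordinal _ = ord0); last exact: val_inj.
move=> E; rewrite -[RHS](perm_comp1 x); apply/esym.
have {E} : c ord0 ∘ 1 = c ord0 ∘
    (simple i ∘ simple i' ∘ simple i ∘ simple i' ∘ simple i ∘ simple i').
  by rewrite perm_comp1 {1}E !perm_compA.
rewrite {1 2}/perm_comp => /mulIg->.
by rewrite !perm_compA.
Qed.

Lemma around_comm i i' x u m :
  u ∘ simple i = simple i ∘ u -> u ∘ simple i' = simple i' ∘ u ->
  around i i' (x ∘ u) m = around i i' x m ∘ u.
Proof.
move=> ui ui'; elim: m => //= m ->.
by case: odd; rewrite -!perm_compA ?ui ?ui'.
Qed.

End PrimitiveCycle.

(** * Invariants of equivalent cycles, and translation of cycles *)

Section CycleEquiv.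
Variable n : nat.
Variables i i' : 'I_n.-1.
Hypothesis Di' : i' = i.+1 :> nat.
Implicit Types (x y z u : 'S_n) (j : 'I_n.-1) (C : subgraph 'S_n).
Implicit Types (ts : seq 'I_n.-1).

Notation word ts := (\big[@perm_comp 'I_n/1%g]_(j <- ts) simple j).

Lemma block_third : block i = [set lo i; hi i; hi i'].
Proof. by apply/setP => a; rewrite !inE -!val_eqE /= Di'; lia. Qed.

(** With [A] the image of [below i] under [x] and [B] the image of a pair in the block, the parity
    at [x] is odd. Odd parity at [y] then forces [A] and [B] to be such images under [y] too. *)
Lemma around_parity_inj x y :
  (forall A B,
    walk_parity (marked i A B) x [seq around i i' x m | m <- iota 1 6] =
    walk_parity (marked i A B) y [seq around i i' y m | m <- iota 1 6]) ->
  x @: below i = y @: below i /\ x @: block i = y @: block i.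
Proof.
move=> par; have lt_lohi : lo i != hi i by rewrite -val_eqE /= neq_ltn ltnSn.
have ne_lo3 : lo i != hi i' by rewrite -val_eqE /= Di'; lia.
have ne_hi3 : hi i != hi i' by rewrite -val_eqE /= Di'; lia.
have pair_ne (z : 'S_n) a b c d : a != c -> a != d ->
    ([set z a; z b] == [set z c; z d]) = false.
  move=> ac ad; apply/negbTE/negP => /eqP/setP/(_ (z a)).
  by rewrite !inE eqxx !(inj_eq perm_inj) (negPf ac) (negPf ad).
have ne12 : ([set x (lo i); x (hi i)] == [set x (hi i); x (hi i')]) = false.
  exact: pair_ne.
have ne23 : ([set x (lo i); x (hi i')] == [set x (hi i); x (hi i')]) = false.
  exact: pair_ne.
have ne13 : ([set x (lo i); x (hi i)] == [set x (lo i); x (hi i')]) = false.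
  by rewrite (setUC [set x (lo i)] [set x (hi i)]) pair_ne // eq_sym.
have y_pair a b : a \in block i -> b \in block i ->
    [set y a; y b] \subset y @: block i.
  by move=> ai bi; apply/subsetP => _ /set2P[]->; apply: imset_f.
have found B : (x @: [set lo i; hi i] == B) (+) (x @: [set hi i; third i'] == B)
      (+) (x @: [set lo i; third i'] == B) ->
    x @: below i = y @: below i /\ B \subset y @: block i.
  move=> xB; have := par (x @: below i) B.
  rewrite !(walk_parity_around _ _ Di') xB eqxx => /esym/andP[/eqP-> yB].
  split=> //; move: yB; rewrite /third !(imsetU1, imset_set1).
  case: eqP => [<- _|_]; first by rewrite y_pair // block_third !inE eqxx ?orbT.
  case: eqP => [<- _|_]; first by rewrite y_pair // block_third !inE eqxx ?orbT.
  by case: eqP => // <- _; rewrite y_pair // block_third !inE eqxx ?orbT.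
(* Exactly one of the three tests succeeds, since the three pairs of values are distinct. *)
have [eq_below xy1] : x @: below i = y @: below i /\
    [set x (lo i); x (hi i)] \subset y @: block i.
  apply: found; rewrite /third !(imsetU1, imset_set1) eqxx.
  by rewrite ![_ == [set x (lo i); x (hi i)]]eq_sym ne12 ne13.
have [_ xy2] : x @: below i = y @: below i /\
    [set x (hi i); x (hi i')] \subset y @: block i.
  apply: found; rewrite /third !(imsetU1, imset_set1) eqxx.
  by rewrite ne12 ne23.
(* The two pairs found cover the image of the block under [x], and both images have the same
   cardinality. *)
split=> //; apply/eqP; rewrite eqEcard !card_imset ?leqnn ?andbT; try exact: perm_inj.
apply/subsetP => _ /imsetP[a ai ->]; move: ai; rewrite {1}block_third !inE -orbA.
by case/or3P=> /eqP->; [apply: (subsetP xy1) | apply: (subsetP xy2) |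
  apply: (subsetP xy2)]; rewrite !inE eqxx ?orbT.
Qed.

Lemma cycle_equiv_images sigma0 C1 C2 :
  primitive6 i i' C1 -> primitive6 i i' C2 -> cycle_equiv sigma0 C1 C2 ->
  exists x y, [/\ x \in sub_vertices C1, y \in sub_vertices C2,
    x @: below i = y @: below i & x @: block i = y @: block i].
Proof.
move=> pC1 pC2 [p1 [p2 [c1 [c2 [_ _ tr1 tr2 hom]]]]].
case: tr1 => [j1 [j1' [pC1' x1 Dc1]]]; case: tr2 => [j2 [j2' [pC2' x2 Dc2]]].
have [Ej1 Ej1'] := primitive6_labels pC1 pC1'.
have [Ej2 Ej2'] := primitive6_labels pC2 pC2'.
subst j1 j1' j2 j2' c1 c2.
exists (last sigma0 p1), (last sigma0 p2).
suff [] : last sigma0 p1 @: below i = last sigma0 p2 @: below i /\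
          last sigma0 p1 @: block i = last sigma0 p2 @: block i by [].
apply: around_parity_inj => A B.
apply: (lasso_parity_homotopic (@marked_sym _ _ _ _) (@marked_irr _ _ _ _)
          (@marked_square _ _ _ _) _ _ hom).
  exact: around6 pC1.
exact: around6 pC2.
Qed.

Lemma adj_simple x j : permutahedron_adj x (x ∘ simple j).
Proof. by apply/permutahedron_adjP; exists j. Qed.

(** The path grows by one edge per letter, and the closed walk is translated across that edge. Hence
    [c] is a family of closed walks, one at each vertex. *)
Lemma homotopic_translate_word (c : 'S_n -> seq 'S_n) sigma0 p ts :
  (forall x, path (@wadj (permutahedron n)) x (c x)) ->
  (forall x, last x (c x) = x) ->
  (forall j x, j \in ts ->
     all2 (@wadj (permutahedron n)) (c x) (c (x ∘ simple j))) ->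
  path (@permutahedron_adj n) sigma0 p ->
  exists q, [/\ path (@permutahedron_adj n) sigma0 q,
    last sigma0 q = last sigma0 p ∘ word ts &
    @G_homotopic (permutahedron n) sigma0
      (@loop_of_walk (permutahedron n) sigma0
        (@lasso (permutahedron n) sigma0 p (c (last sigma0 p))))
      (@loop_of_walk (permutahedron n) sigma0
        (@lasso (permutahedron n) sigma0 q (c (last sigma0 q))))].
Proof.
move=> c_path c_last; elim: ts p => [|t ts IHts] p c_ts sp.
  have wsp := @path_adj_wadj (permutahedron n) _ _ sp.
  exists p; split=> //; first by rewrite big_nil perm_comp1.
  have lp : @loop (permutahedron n) sigma0 (loop_of_walk (G := permutahedron n)
      sigma0 (lasso (G := permutahedron n) sigma0 p (c (last sigma0 p)))).
    by apply: loop_of_walkP; [apply: lasso_path | apply: last_lasso].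
  by apply: (G_homotopic1 lp lp) => r; apply: wadjxx.
have wsp := @path_adj_wadj (permutahedron n) _ _ sp.
set x := last sigma0 p; have [||q [sq lq hom]] := IHts (rcons p (x ∘ simple t)).
- by move=> j y jts; apply: c_ts; rewrite inE jts orbT.
- by rewrite rcons_path sp; apply: adj_simple.
exists q; split=> //; first by rewrite lq last_rcons big_cons perm_compA.
apply: G_homotopic_trans hom; rewrite last_rcons.
apply: homotopic_translate => //; first by apply: adj_wadj; apply: adj_simple.
by apply: c_ts; rewrite mem_head.
Qed.

Lemma around_path x m : path (@wadj (permutahedron n)) (around i i' x m)
  [seq around i i' x l | l <- iota m.+1 6].
Proof. by apply: path_adj_wadj; rewrite /= !adj_simple. Qed.

Lemma around_all2 x j s :
  disjoint_perm (simple j) (simple i) -> disjoint_perm (simple j) (simple i') ->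
  all2 (@wadj (permutahedron n)) [seq around i i' x m | m <- s]
    [seq around i i' (x ∘ simple j) m | m <- s].
Proof.
move=> /disjoint_comm ji /disjoint_comm ji'; elim: s => //= m s ->.
by rewrite andbT (around_comm _ _ ji ji'); apply: adj_wadj; apply: adj_simple.
Qed.

Lemma cycle_equiv_translate sigma0 C1 C2 sigma1 ts :
  primitive6 i i' C1 -> primitive6 i i' C2 -> sigma1 \in sub_vertices C1 ->
  sigma1 ∘ word ts \in sub_vertices C2 ->
  (forall j, j \in ts -> disjoint_perm (simple j) (simple i) /\
                          disjoint_perm (simple j) (simple i')) ->
  cycle_equiv sigma0 C1 C2.
Proof.
move=> pC1 pC2 s1 g1 far; have [p sp lp] := permutahedron_connected sigma0 sigma1.
pose c x := [seq around i i' x m | m <- iota 1 6].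
have [|||q [sq lq hom]] := @homotopic_translate_word c sigma0 p ts _ _ _ sp.
- by move=> x; apply: (around_path x 0).
- by move=> x; apply: (around6 x pC1).
- by move=> j x /far[]; apply: around_all2.
exists p, q, (c (last sigma0 p)), (c (last sigma0 q)); split=> //.
  by exists i, i'; rewrite lp.
by exists i, i'; rewrite lq lp.
Qed.

Lemma mem_below u : u @: below i = below i -> forall a, (u a < i) = (a < i).
Proof.
move=> uL a; have := mem_imset (below i) a (@perm_inj _ u).
by rewrite uL !inE.
Qed.

Lemma mem_block u : u @: block i = block i ->
  forall a, ((i <= u a) && (u a <= i.+2)) = ((i <= a) && (a <= i.+2)).
Proof.
move=> uM a; have := mem_imset (block i) a (@perm_inj _ u).
by rewrite uM !inE.
Qed.

(** Such a [u] preserves the positions before, in and after the block, so no descent straddles a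
    boundary, and none lies inside the block, where [u] is the identity. Removing a descent keeps
    both hypotheses. *)
Lemma young_word u :
  u @: below i = below i -> (forall a, a \in block i -> u a = a) ->
  exists2 ts, u = word ts &
    forall j, j \in ts -> disjoint_perm (simple j) (simple i) /\
                           disjoint_perm (simple j) (simple i').
Proof.
elim/descent_ind: u => [|u j desc IHu] uL uM; first by exists [::]; rewrite ?big_nil.
have blockE : u @: block i = block i.
  by apply: perm_imset_subset => _ /imsetP[a ai ->]; rewrite uM.
have [jL jL'] := (mem_below uL (lo j), mem_below uL (hi j)).
have [jM jM'] := (mem_block blockE (lo j), mem_block blockE (hi j)).
have jfar : (j.+1 < i) || (i.+2 < j).
  have fix_lo : i <= j <= i.+2 -> u (lo j) = j :> nat by move=> ij; rewrite uM ?inE.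
  have fix_hi : i <= j.+1 <= i.+2 -> u (hi j) = j.+1 :> nat.
    by move=> ij; rewrite uM ?inE.
  by move: desc jL jL' jM jM' fix_lo fix_hi => /=; lia.
have [ji ji'] : disjoint_perm (simple j) (simple i) /\
    disjoint_perm (simple j) (simple i').
  by split; apply: disjoint_simple; lia.
have [||ts Du ts_far] := IHu.
- by rewrite imset_comp_perm simple_below //; lia.
- move=> a ai; rewrite perm_compE (_ : simple j a = a) ?uM //.
  by apply: val_inj; rewrite /= val_simple; move: ai; rewrite inE; do !case: eqP; lia.
exists (rcons ts j); last by move=> l; rewrite mem_rcons inE => /predU1P[->|/ts_far].
have word_rcons s : word (rcons s j) = word s ∘ simple j.
  elim: s => [|l s IHs] /=; last by rewrite !big_cons IHs perm_compA.
  by rewrite big_cons !big_nil /perm_comp mulg1 mul1g.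
by rewrite word_rcons -Du perm_comp_simpleK.
Qed.

End CycleEquiv.

(** * The effect of minimality of the path *)

Section Shortest.
Variable n : nat.
Variables i i' : 'I_n.-1.
Hypothesis Di' : i' = i.+1 :> nat.

(* Otherwise the last vertex of the path could be moved one step along C2 to
   shorten the path. *)
Lemma shortest_fixes_block C1 C2 (sigma u : 'S_n) p :
  primitive6 i i' C2 ->
  @shortest_path (permutahedron n) (mem (sub_vertices C1))
    (mem (sub_vertices C2)) sigma p (sigma ∘ u) ->
  u @: block i = block i -> forall a, a \in block i -> u a = a.
Proof.
move=> pC2 [sC1 gC2 sp lp pmin] uM.
have asc j : sigma ∘ u ∘ simple j \in sub_vertices C2 -> u (lo j) < u (hi j).
  move=> gjC2; rewrite ltn_neqAle val_eqE (inj_eq perm_inj) -val_eqE /=.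
  rewrite neq_ltn ltnSn /= leqNgt; apply/negP => desc.
  have [q [sq lq size_q]] := permutahedron_path sigma (u ∘ simple j).
  have := pmin sigma q sC1 sq; rewrite lq perm_compA => /(_ gjC2).
  by rewrite size_q leqNgt -(inv_descent desc) (inv_shortest sp lp).
have [/asc asc_i /asc asc_i'] := primitive6_step pC2 gC2.
have := (mem_block uM (lo i), mem_block uM (hi i), mem_block uM (hi i')).
(* On the three positions of the block [u] is increasing, and it maps the block to itself, so it
   fixes each of them. *)
rewrite (lo_succ Di') in asc_i'; rewrite /= Di' => -[[b0 b1] b2] a.
rewrite (block_third Di') !inE -orbA => /or3P[]/eqP->; apply: val_inj => /=; lia.
Qed.

End Shortest.

Theorem theorem5p2 (n : nat) (sigma0 : 'S_n) (i i' : 'I_n.-1)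
    (C1 C2 : subgraph 'S_n) (sigma1 gamma1 : 'S_n) (p : seq 'S_n) :
  i' = i.+1 :> nat ->
  primitive6 i i' C1 ->
  primitive6 i i' C2 ->
  C1 <> C2 ->
  @shortest_path (permutahedron n) (mem (sub_vertices C1))
    (mem (sub_vertices C2)) sigma1 p gamma1 ->
  (cycle_equiv sigma0 C1 C2 <->
   exists (k : nat) (tau : 'I_k -> 'I_n.-1),
     [/\ 1 <= k,
         forall l : 'I_k, disjoint_perm (simple (tau l)) (simple i) /\
                          disjoint_perm (simple (tau l)) (simple i') &
         forall j : 'I_6,
           around i i' gamma1 j =
           around i i' sigma1 j
             ∘ \big[@perm_comp 'I_n/1%g]_(l < k) simple (tau l)]).
Proof.
move=> Di' pC1 pC2 neqC sh; have [s1 g1 sp lp _] := sh.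
split=> [equiv | [k [tau [_ far eq_around]]]]; last first.
  pose ts := [seq tau l | l <- index_enum 'I_k].
  apply: (cycle_equiv_translate (ts := ts) sigma0 pC1 pC2 s1).
    (* At index 0 the walk around is at its base vertex, which gives [gamma1] as [sigma1] times the
       word. *)
    by have /= := eq_around ord0; rewrite big_map => <-.
  by move=> _ /mapP[l _ ->]; apply: far.
have [x [y [xC1 yC2 xyL xyM]]] := cycle_equiv_images Di' pC1 pC2 equiv.
pose u := sigma1^-1 ∘ gamma1; have Dg : gamma1 = sigma1 ∘ u.
  by rewrite perm_compA /perm_comp mulVg mulg1.
have images_u (A : {set 'I_n}) : sigma1 @: A = gamma1 @: A -> u @: A = A.
  move=> E; rewrite imset_comp_perm -E -imset_comp_perm /perm_comp mulgV.
  by rewrite -[RHS]imset_id; apply: eq_imset => a; rewrite perm1.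
(* The two images are constant on each cycle, so their equality passes from [x], [y] to [sigma1],
   [gamma1]. *)
have uL : u @: below i = below i.
  apply: images_u; rewrite (primitive6_below pC1 s1 xC1) xyL.
  exact: primitive6_below pC2 yC2 g1.
have uM : u @: block i = block i.
  apply: images_u; rewrite (primitive6_block pC1 s1 xC1) xyM.
  exact: primitive6_block pC2 yC2 g1.
have u_fix := shortest_fixes_block Di' pC2 _ uM.
rewrite Dg in sh u_fix; have [ts Du far] := young_word Di' uL (u_fix _ _ _ sh).
exists (size ts), (tnth (in_tuple ts)); split.
(* For an empty word the two cycles would share the vertex [sigma1] and coincide. *)
- rewrite lt0n; apply/eqP => /size0nil ts0; case: neqC.
  apply: (primitive6_eq pC1 pC2 s1); rewrite Dg Du ts0 big_nil perm_comp1 in g1.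
  exact: g1.
- by move=> l; apply/far/mem_tnth.
have -> : \big[@perm_comp 'I_n/1]_(l < size ts) simple (tnth (in_tuple ts) l) = u.
  by rewrite Du [RHS]big_tnth.
(* As a product of disjoint letters, [u] commutes with both labels, so it can be moved past each
   step around the cycle. *)
have comm j : (forall l, l \in ts -> disjoint_perm (simple l) (simple j)) ->
    u ∘ simple j = simple j ∘ u.
  rewrite Du; elim: ts {Du far} => [|t ts IHts] tj.
    by rewrite big_nil /perm_comp mulg1 mul1g.
  rewrite big_cons -perm_compA IHts ?perm_compA; last first.
    by move=> l lts; apply: tj; rewrite inE lts orbT.
  by rewrite (disjoint_comm (tj t (mem_head _ _))).
by move=> j; rewrite Dg around_comm //; apply: comm => l /far[].
Qed.
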